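(* Let $(G,X)$ be a strongly marked group. If $(G,X)$ has Property $\mathcal D$, then $(G,X)$ is a quasi-Dyer system.
   Context: Notation. A marked group is a pair $(G,X)$ with $G$ a group and $X\subset G$ a generating set. $o(g)$ is the order of $g$; $\mathbb Z_{o(g)}=\mathbb Z/o(g)\mathbb Z$ if $o(g)$ is finite and $\mathbb Z_{o(g)}=\mathbb Z$ otherwise. The set of syllables is $S(X)=\{x^a\mid x\in X,\ a\in\mathbb Z_{o(x)}\setminus\{0\}\}$. $S(X)^*$ is the free monoid on $S(X)$; its elements are called syllabic words, written as finite sequences, with concatenation written $w\cdot w'$. For $w=(s_1,\dots,s_\ell)$, $\overline w=s_1\cdots s_\ell\in G$. The syllabic length $\lg_{S(X)}(g)$ is the shortest length of a syllabic word $w$ with $\overline w=g$; a word $w$ of length $\ell$ is reduced if $\ell=\lg_{S(X)}(\overline w)$. For $m\ge2$, $[a,b]_m$ is the alternating word $(a,b,a,\dots)$ of length $m$, and $\overline{[a,b]}_m$ is the alternating product $aba\cdots$ with $m$ factors. Strongly marked. $(G,X)$ is strongly marked if $1\notin X$ and, for all $x,y\in X$, $s\in\langle x\rangle\setminus\{1\}$, $t\in\langle y\rangle\setminus\{1\}$: if $st\in S(X)\cup\{1\}$ then $x=y$. M-operations. Type I: if $w=w_1\cdot(s,t)\cdot w_2$ with $s,t\in S(X)$ and $st\in S(X)\cup\{1\}$, replace $w$ by $w_1\cdot(st)\cdot w_2$ if $st\ne1$, and by $w_1\cdot w_2$ if $st=1$. Type II: if $w=w_1\cdot[s,t]_m\cdot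 w_2$ with $s,t\in S(X)$, $m\ge2$, $\overline{[s,t]}_m=\overline{[t,s]}_m$ and $\lg_{S(X)}(\overline{[s,t]}_m)=m$, replace $w$ by $w_1\cdot[t,s]_m\cdot w_2$. A word is M-reduced if its length cannot be shortened by any finite sequence of elementary M-operations. Property $\mathcal D$. $(G,X)$ has Property $\mathcal D$ if (a) every $w\in S(X)^*$ is reduced if and only if it is M-reduced, and (b) for all reduced $w,w'\in S(X)^*$ with $\overline w=\overline{w'}$, one can go from $w$ to $w'$ through a finite sequence of elementary M-operations of type II. Quasi-Dyer systems. Let $\Gamma$ be a simplicial graph (possibly infinite) with vertex set $V(\Gamma)$ and edge set $E(\Gamma)$, with maps $m:E(\Gamma)\to\mathbb N_{\ge2}$ and $f:V(\Gamma)\to\mathbb N_{\ge2}\cup\{\infty\}$ such that for each edge $e=\{u,v\}$: if $m(e)>2$ is even, then $f(u)=f(v)=2$; if $m(e)>2$ is odd, then $f(u)$ and $f(v)$ are both finite and even and at least one of them equals $2$. The quasi-Dyer group $QD(\Gamma,m,f)$ is the group with generators $x_v$ ($v\in V(\Gamma)$) and relations: $x_v^{f(v)}=1$ whenever $f(v)\ne\infty$; $x_ux_v=x_vx_u$ for all $e=\{u,v\}\in E(\Gamma)$ with $m(e)=2$; $\overline{[x_u^{f(u)/2},x_v^{f(v)/2}]}_{m(e)}=\overline{[x_v^{f(v)/2},x_u^{f(u)/2}]}_{m(e)}$ for all $e=\{u,v\}\in E(\Gamma)$ with $m(e)>2$. A marked group $(G,X)$ is a quasi-Dyer system if there is such a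 triple $(\Gamma,m,f)$ with $G=QD(\Gamma,m,f)$ and $X=\{x_v\mid v\in V(\Gamma)\}$ (i.e. up to a group isomorphism carrying $\{x_v\mid v\in V(\Gamma)\}$ onto $X$). *)

(* Defs.v *)
From HB Require Import structures.
From Stdlib Require Export Relation_Operators.
From mathcomp Require Export all_boot ssralg ssrint intdiv.
From mathcomp Require Export boolp classical_sets.

Set Implicit Arguments.
Unset Strict Implicit.
Unset Printing Implicit Defensive.

Local Open Scope classical_set_scope.
Local Open Scope group_scope.
Local Open Scope quotient_scope.

Definition least (P : set nat) : option nat :=
  xget None [set o | exists n, [/\ o = Some n, P n & forall k, P k -> n <= k]].

Definition alternate (T : Type) (s t : T) (m : nat) : seq T :=
  mkseq (fun i => if odd i then t else s) m.

Section MarkedGroups.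
Variables (G : groupType) (X : set G).
Implicit Types (g s t x y : G) (w : seq G).

Definition is_subgroup (H : set G) : Prop :=
  [/\ H 1, forall g h, H g -> H h -> H (g * h) & forall g, H g -> H g^-1].

Definition subgroup_gen (A : set G) : set G := smallest is_subgroup A.

Definition generates : Prop := subgroup_gen X = setT.

(* [None] encodes infinite order. *)
Definition order g : option nat := least [set n | 0 < n /\ g ^+ n = 1].

Definition expgz g (a : int) : G :=
  match a with Posz n => g ^+ n | Negz n => g ^- n.+1 end.

(* [a] represents a nonzero class of [Z/o], resp. of [Z] if [o] is infinite. *)
Definition nonzero_mod (o : option nat) (a : int) : Prop :=
  if o is Some n then ~ (n %| a)%Z else a <> 0%R.

Definition syllable : set G :=
  [set s | exists x a, [/\ X x, nonzero_mod (order x) a & s = expgz x a]].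

Definition syllabic : set (seq G) := [set w | forall s, s \in w -> syllable s].

Definition wprod w : G := \prod_(s <- w) s.

(* Never [None] when [X] generates [G]. *)
Definition syl_length g : option nat :=
  least [set l | exists w, [/\ syllabic w, wprod w = g & size w = l]].

Definition reduced w : Prop := syl_length (wprod w) = Some (size w).

Definition strongly_marked : Prop :=
  ~ X 1 /\
  forall x y s t, X x -> X y ->
    subgroup_gen [set x] s -> s <> 1 -> subgroup_gen [set y] t -> t <> 1 ->
    syllable (s * t) \/ s * t = 1 -> x = y.

Inductive M_op1 : seq G -> seq G -> Prop :=
| M_op1_merge w1 w2 s t of syllable s & syllable t & syllable (s * t)
    & s * t <> 1 : M_op1 (w1 ++ [:: s; t] ++ w2) (w1 ++ [:: s * t] ++ w2)
| M_op1_cancel w1 w2 s t of syllable s & syllable t & s * t = 1 :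
    M_op1 (w1 ++ [:: s; t] ++ w2) (w1 ++ w2).

Inductive M_op2 : seq G -> seq G -> Prop :=
| M_op2_swap w1 w2 s t m of syllable s & syllable t & 1 < m
    & wprod (alternate s t m) = wprod (alternate t s m)
    & syl_length (wprod (alternate s t m)) = Some m :
    M_op2 (w1 ++ alternate s t m ++ w2) (w1 ++ alternate t s m ++ w2).

Definition M_op w w' : Prop := M_op1 w w' \/ M_op2 w w'.

Definition M_reduced w : Prop :=
  forall w', clos_refl_trans _ M_op w w' -> size w <= size w'.

Definition property_D : Prop :=
  (forall w, syllabic w -> (reduced w <-> M_reduced w)) /\
  (forall w w', syllabic w -> syllabic w' -> reduced w -> reduced w' ->
     wprod w = wprod w' -> clos_refl_trans _ M_op2 w w').

End MarkedGroups.

Section Presentations.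
Variable V : Type.

(* [(v, false)] stands for the generator [v], [(v, true)] for its inverse. *)
Definition gword := seq ({classic V} * bool).

Definition gword_inv (u : gword) : gword := [seq (p.1, ~~ p.2) | p <- rev u].

Variable R : gword -> gword -> Prop.

Inductive rel_cong : gword -> gword -> Prop :=
| rel_cong_rel u v of R u v : rel_cong u v
| rel_cong_inv v b : rel_cong [:: (v, b); (v, ~~ b)] [::]
| rel_cong_refl u : rel_cong u u
| rel_cong_sym u v of rel_cong u v : rel_cong v u
| rel_cong_trans v u w of rel_cong u v & rel_cong v w : rel_cong u w
| rel_cong_cat u u' v v' of rel_cong u u' & rel_cong v v' :
    rel_cong (u ++ v) (u' ++ v').

Lemma rel_cong_mulVw u : rel_cong (gword_inv u ++ u) [::].
Proof.
elim: u => [|[x b] u IH]; first exact: rel_cong_refl.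
rewrite /gword_inv rev_cons map_rcons -cats1 -catA /=.
apply: (rel_cong_trans _ IH); apply: rel_cong_cat; first exact: rel_cong_refl.
rewrite -[X in rel_cong _ X]cat0s -[X in rel_cong X _]/([:: _; _] ++ u).
apply: rel_cong_cat; last exact: rel_cong_refl.
by have := rel_cong_inv x (~~ b); rewrite negbK.
Qed.

Lemma gword_invK : involutive gword_inv.
Proof.
move=> u; rewrite /gword_inv -map_rev revK -map_comp -[RHS]map_id.
by apply: eq_map => -[x b] /=; rewrite negbK.
Qed.

Lemma rel_cong_mulwV u : rel_cong (u ++ gword_inv u) [::].
Proof. by have := rel_cong_mulVw (gword_inv u); rewrite gword_invK. Qed.

Lemma rel_cong_invw u v : rel_cong u v -> rel_cong (gword_inv u) (gword_inv v).
Proof.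
move=> uv; rewrite -[gword_inv u]cats0 -[gword_inv v]cat0s.
apply: (@rel_cong_trans (gword_inv u ++ (v ++ gword_inv v))).
  by apply: rel_cong_cat; [exact: rel_cong_refl|
    exact/rel_cong_sym/rel_cong_mulwV].
rewrite catA; apply: rel_cong_cat; last exact: rel_cong_refl.
apply: (rel_cong_trans _ (rel_cong_mulVw u)).
by apply: rel_cong_cat; [exact: rel_cong_refl|exact: rel_cong_sym].
Qed.

Definition rel_congb (u v : gword) : bool := `[< rel_cong u v >].

Lemma rel_congb_refl : reflexive rel_congb.
Proof. by move=> u; apply/asboolP/rel_cong_refl. Qed.

Lemma rel_congb_sym : symmetric rel_congb.
Proof. by move=> u v; apply/asboolP/asboolP => /rel_cong_sym. Qed.

Lemma rel_congb_trans : transitive rel_congb.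
Proof.
by move=> v u w /asboolP uv /asboolP vw; apply/asboolP/(rel_cong_trans uv vw).
Qed.

Canonical rel_congb_equiv :=
  EquivRel rel_congb rel_congb_refl rel_congb_sym rel_congb_trans.

Definition presented : Type := {eq_quot rel_congb}.
HB.instance Definition _ := Choice.on presented.

Definition of_gword (u : gword) : presented := \pi_{eq_quot rel_congb} u.
Definition to_gword (a : presented) : gword :=
  repr (a : {eq_quot rel_congb}).

Lemma to_gwordK : cancel to_gword of_gword.
Proof. by move=> a; rewrite /of_gword /to_gword reprK. Qed.

Lemma of_gword_eqP (u v : gword) :
  of_gword u = of_gword v <-> rel_cong u v.
Proof.
split=> [/eqP|uv]; first by rewrite eqmodE => /asboolP.
by apply/eqP; rewrite eqmodE; apply/asboolP.
Qed.

Lemma to_of_gword (u : gword) : rel_cong (to_gword (of_gword u)) u.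
Proof. by apply/of_gword_eqP; rewrite to_gwordK. Qed.

Definition presented_mul (a b : presented) : presented :=
  of_gword (to_gword a ++ to_gword b).
Definition presented_one : presented := of_gword [::].
Definition presented_inv (a : presented) : presented :=
  of_gword (gword_inv (to_gword a)).

Lemma presented_mulE u v :
  presented_mul (of_gword u) (of_gword v) = of_gword (u ++ v).
Proof. by apply/of_gword_eqP/rel_cong_cat; exact: to_of_gword. Qed.

Lemma presented_invE u :
  presented_inv (of_gword u) = of_gword (gword_inv u).
Proof. by apply/of_gword_eqP/rel_cong_invw/to_of_gword. Qed.

Lemma presented_mulA : associative presented_mul.
Proof.
move=> a b c; rewrite -[a]to_gwordK -[b]to_gwordK -[c]to_gwordK.
by rewrite !presented_mulE catA.
Qed.

Lemma presented_mul1 : left_id presented_one presented_mul.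
Proof. by move=> a; rewrite -[a]to_gwordK presented_mulE. Qed.

Lemma presented_mulr1 : right_id presented_one presented_mul.
Proof. by move=> a; rewrite -[a]to_gwordK presented_mulE cats0. Qed.

Lemma presented_mulV : left_inverse presented_one presented_inv presented_mul.
Proof.
move=> a; rewrite -[a]to_gwordK presented_invE presented_mulE /presented_one.
by apply/of_gword_eqP/rel_cong_mulVw.
Qed.

Lemma presented_mulrV : right_inverse presented_one presented_inv presented_mul.
Proof.
move=> a; rewrite -[a]to_gwordK presented_invE presented_mulE /presented_one.
by apply/of_gword_eqP/rel_cong_mulwV.
Qed.

HB.instance Definition _ := isGroup.Build presented
  presented_mulA presented_mul1 presented_mulr1 presented_mulV presented_mulrV.

Definition presented_gen (v : V) : presented :=
  of_gword [:: (v : {classic V}, false)].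

Definition gpow (v : V) (n : nat) : gword := nseq n (v : {classic V}, false).

End Presentations.

(* [None] encodes the value infinity of [qd_f]; the values of [qd_m] at
   non-adjacent pairs are irrelevant. *)
Record quasi_dyer_graph : Type := QuasiDyerGraph {
  qd_vertex : Type;
  qd_adj : qd_vertex -> qd_vertex -> Prop;
  qd_m : qd_vertex -> qd_vertex -> nat;
  qd_f : qd_vertex -> option nat;
  qd_adj_sym : forall u v, qd_adj u v -> qd_adj v u;
  qd_adj_irr : forall u, ~ qd_adj u u;
  qd_m_sym : forall u v, qd_adj u v -> qd_m u v = qd_m v u;
  qd_m_ge2 : forall u v, qd_adj u v -> 2 <= qd_m u v;
  qd_f_ge2 : forall v p, qd_f v = Some p -> 2 <= p;
  qd_even : forall u v, qd_adj u v -> 2 < qd_m u v -> ~~ odd (qd_m u v) ->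
    qd_f u = Some 2 /\ qd_f v = Some 2;
  qd_odd : forall u v, qd_adj u v -> 2 < qd_m u v -> odd (qd_m u v) ->
    exists p q, [/\ qd_f u = Some p, qd_f v = Some q, ~~ odd p, ~~ odd q
                  & p = 2 \/ q = 2]
}.

Inductive qd_rel (D : quasi_dyer_graph) :
  gword (qd_vertex D) -> gword (qd_vertex D) -> Prop :=
| qd_rel_order (v : qd_vertex D) p of qd_f v = Some p :
    qd_rel (gpow v p) [::]
| qd_rel_comm (u v : qd_vertex D) of qd_adj u v & qd_m u v = 2 :
    qd_rel (gpow u 1%N ++ gpow v 1%N) (gpow v 1%N ++ gpow u 1%N)
| qd_rel_braid (u v : qd_vertex D) p q of qd_adj u v & 2 < qd_m u v
    & qd_f u = Some p & qd_f v = Some q :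
    qd_rel (flatten (alternate (gpow u p./2) (gpow v q./2) (qd_m u v)))
           (flatten (alternate (gpow v q./2) (gpow u p./2) (qd_m u v))).

Definition QD (D : quasi_dyer_graph) : groupType := presented (@qd_rel D).

Definition qd_gen (D : quasi_dyer_graph) (v : qd_vertex D) : QD D :=
  presented_gen (@qd_rel D) v.

Definition quasi_dyer_system (G : groupType) (X : set G) : Prop :=
  exists (D : quasi_dyer_graph) (phi : {multiplicative QD D -> G}),
    bijective phi /\ phi @` range (@qd_gen D) = X.

(* Main.v *)
(* Property D is used through one principle: if two distinct syllabic words
   represent the same element, then the one that is not the shorter admits an
   elementary M-operation that changes it; when its consecutive letters lie in
   alternating cyclic subgroups <x>, <y>, this operation is of type II.  Given a
   braid relation [s, t]_m = [t, s]_m with s in <x> and t in <y>, put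
   d = [t, s]_(m-1), so that s d = d r with r = t (m odd) or r = s (m even).
   Comparing (g, d, h) with (g s, d, r^-1 h), for g in <x> and h in the cyclic
   subgroup containing r, forces x and y to commute if m = 2, and g = s or
   h = r if m > 2.  Choosing g and h to be inverses of s and r, or generators,
   yields that s and t are involutions, that x = s and y = t for m even, and that
   x = s or y = t for m odd.  So these relations define a quasi-Dyer graph on X
   and a morphism from its group onto G.  It is injective: M-operations lift to
   the quasi-Dyer group, and a word representing 1 is shortened to the empty
   word by M-operations. *)
From HB Require Import structures.
Require Import Defs.
From mathcomp Require Import zify.

Set Implicit Arguments.
Unset Strict Implicit.
Unset Printing Implicit Defensive.

Local Open Scope group_scope.

(** * Preliminaries: chains of steps, alternating words, least numbers *)

Lemma clos_refl_trans_first_step (T : Type) (R : T -> T -> Prop) (a b : T) :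
  clos_refl_trans T R a b -> a <> b -> exists2 c, R a c & c <> a.
Proof.
elim=> [u v Ruv uv|u //|u v w _ IHuv _ IHvw uw].
  by exists v => // vu; apply: uv.
by have [uv|/IHuv//] := pselect (u = v); rewrite uv in uw *; exact: IHvw.
Qed.

Section Alternate.
Variable T : Type.
Implicit Types s t : T.

Lemma size_alternate s t n : size (alternate s t n) = n.
Proof. exact: size_mkseq. Qed.

Lemma nth_alternate x0 s t n i :
  i < n -> nth x0 (alternate s t n) i = if odd i then t else s.
Proof. by move=> ltin; rewrite nth_mkseq. Qed.

Lemma alternateS s t n : alternate s t n.+1 = s :: alternate t s n.
Proof.
apply: (@eq_from_nth _ s) => [|[|i]]; rewrite /= ?size_mkseq ?size_map ?size_iota //=.
move=> ltin; rewrite !nth_mkseq //= (nth_map 0%N) ?size_iota // nth_iota //=.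
by case: (odd i).
Qed.

Lemma alternateSr s t n :
  alternate s t n.+1 = rcons (alternate s t n) (if odd n then t else s).
Proof. by rewrite /alternate /mkseq -[n.+1]addn1 iotaD map_cat cats1. Qed.

Lemma alternateD s t m n : alternate s t (m + n) =
  alternate s t m ++ (if odd m then alternate t s n else alternate s t n).
Proof.
elim: m s t => [|m IHm] s t //; rewrite addSn !alternateS IHm /=.
by case: (odd m).
Qed.

(* The interior letters have indices 1, ..., n, hence the parity shift. *)
Lemma nth_frame_alternate x0 a b s t n i :
  nth x0 (a :: rcons (alternate s t n) b) i =
    if i == 0%N then a else if i <= n then (if odd i then s else t)
    else if i == n.+1 then b else x0.
Proof.
case: i => [|i] //=; rewrite nth_rcons size_alternate; case: ifP => // ltin.
by rewrite nth_alternate //; case: odd.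
Qed.

End Alternate.

Lemma map_alternate (T U : Type) (f : T -> U) s t n :
  map f (alternate s t n) = alternate (f s) (f t) n.
Proof.
by elim: n s t => [|n IHn] s t //; rewrite !alternateS map_cons IHn.
Qed.

Lemma mem_alternate (T : eqType) (s t u : T) n :
  u \in alternate s t n -> u = s \/ u = t.
Proof. by move/mapP => [i _ ->]; case: odd; [right|left]. Qed.

Section Least.

Lemma leastP (P : set nat) o : least P = o ->
  if o is Some n then P n /\ forall k, P k -> n <= k else forall n, ~ P n.
Proof.
move=> <-; rewrite /least.
case: xgetP => [_ -> [n [-> Pn minP]]//|noP n Pn].
have [k /asboolP Pk minP] := ex_minnP (ex_intro (fun n => `[<P n>]) n (asboolT Pn)).
by apply: (noP (Some k)); exists k; split=> // j /asboolP /minP.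
Qed.

Lemma least_exists (P : set nat) n : P n -> exists2 k, least P = Some k & k <= n.
Proof.
move=> Pn; have := leastP (erefl (least P)).
case: (least P) => [k [Pk minP]|noP]; last by case: (noP n).
by exists k => //; exact: minP.
Qed.

End Least.

(** * Integer powers and orders of group elements *)

Section Expgz.
Variable G : groupType.
Implicit Types (x y : G) (a b : int).

Lemma expgzN x a : expgz x (- a)%R = (expgz x a)^-1.
Proof. by case: a => [[|n]|n] /=; rewrite ?invg1 ?invgK. Qed.

Lemma expgzD x a b : expgz x (a + b)%R = expgz x a * expgz x b.
Proof.
have aux (m n : nat) : expgz x (m%:Z - n%:Z)%R = x ^+ m * x ^- n.
  have [le_nm|/ltnW le_mn] := leqP n m.
    by rewrite -[in LHS](subnK le_nm) PoszD GRing.addrK /= expgnFr.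
  rewrite -[in LHS](subnK le_mn) PoszD GRing.opprD GRing.addrC GRing.addrNK.
  by rewrite expgzN /= expgnFr // invgF.
(* Writing an integer as a difference of naturals turns [aux] into the one-step rule [expgzS], from
   which the induction on [a] proceeds. *)
have rep c : exists m n : nat, c = (m%:Z - n%:Z)%R.
  by case: c => n; [exists n, 0|exists 0, n.+1]; rewrite ?NegzE; lia.
have expgzS c : expgz x (1 + c)%R = x * expgz x c.
  have [m [n ->]] := rep c.
  have -> : (1 + (m%:Z - n%:Z) = m.+1%:Z - n%:Z)%R by lia.
  by rewrite !aux expgS mulgA.
elim/int_ind: a => [|n IHn|n IHn].
- by rewrite GRing.add0r mul1g.
- have -> : (n.+1%:Z + b = 1 + (n%:Z + b))%R by lia.
  have -> : (n.+1%:Z = 1 + n%:Z)%R by lia.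
  by rewrite !expgzS IHn mulgA.
- apply: (mulgI x); rewrite mulgA -!expgzS.
  have -> : (1 + (- n.+1%:Z + b) = - n%:Z + b)%R by lia.
  by have -> : (1 - n.+1%:Z = - n%:Z)%R by lia.
Qed.

End Expgz.

Section IntegerPowers.
Variable G : groupType.
Implicit Types (x y : G) (a b : int).

Lemma expgz1 a : expgz (1 : G) a = 1.
Proof. by case: a => n; rewrite /= expg1n ?invg1. Qed.

Lemma expgzMn x a n : expgz x (a * n%:Z)%R = expgz (x ^+ n) a.
Proof.
case: a => k; first by rewrite -PoszM /= mulnC expgnA.
by rewrite NegzE GRing.mulNr -PoszM !expgzN /= mulnC expgnA.
Qed.

Lemma commute_expgz x y a b : commute x y -> commute (expgz x a) (expgz y b).
Proof.
move=> cxy; have aux z c : commute z x -> commute z (expgz x c).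
  by case: c => n czx /=; [|apply: commuteV]; exact: commuteX.
apply: commute_sym; apply: aux; apply: commute_sym.
by case: b => n /=; [|apply: commuteV]; exact: commuteX.
Qed.

(** [o] need not be the order of [x]: in the lift it is the order of a generator of [G], while [x]
    is the image of the matching vertex in another group. *)
Lemma expgz_zero_mod x o a :
  (forall n, o = Some n -> x ^+ n = 1) -> ~ nonzero_mod o a -> expgz x a = 1.
Proof.
case: o => [n|] xo /= /contrapT; last by move->.
by move=> /dvdzP[c ->]; rewrite expgzMn xo // expgz1.
Qed.

Lemma nonzero_mod_order x a : nonzero_mod (order x) a <-> expgz x a <> 1.
Proof.
split=> [|xa1]; last first.
  apply: contrapT => /expgz_zero_mod a0; apply: xa1; apply: a0 => n xn.
  by case: (leastP xn) => -[].
have := leastP (erefl (order x)); case: (order x) => [n|] /=.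
  move=> [[n_gt0 xn] minn] na xa; apply: na; apply/dvdz_mod0P.
  have [r rE ltrn] : exists2 r : nat, (a %% n)%Z = Posz r & r < n.
    by exists `|(a %% n)%Z|%N; lia.
  have : expgz x a = x ^+ r.
    by rewrite (divz_eq a n) rE expgzD expgzMn xn expgz1 mul1g.
  rewrite xa rE; case: r ltrn {rE} => // r ltrn /esym xr.
  by have := minn _ (conj (ltn0Sn r) xr); rewrite leqNgt ltrn.
move=> xn a0 xa; case: a xa a0 => [[//|n]|n] xa _; apply: (xn n.+1); split=> //.
by apply: invg_inj; rewrite invg1.
Qed.

Lemma order_gt0 x n : order x = Some n -> 0 < n.
Proof. by case/leastP => -[]. Qed.

Lemma expg_order x n : order x = Some n -> x ^+ n = 1.
Proof. by case/leastP => -[]. Qed.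

Lemma order_gt1 x n : x <> 1 -> order x = Some n -> 1 < n.
Proof.
by move=> x1 xn; have := order_gt0 xn; have := expg_order xn; case: n {xn} => [|[]].
Qed.

Lemma order_involution x : x <> 1 -> x * x = 1 -> order x = Some 2.
Proof.
move=> x1 xx; have [//|n xn n_le2] :=
  @least_exists (fun n => 0 < n /\ x ^+ n = 1) 2.
by have := order_gt1 x1 xn; rewrite [order x]xn; case: n n_le2 {xn} => [|[|[]]].
Qed.

(** Infinite order is excluded, since [2a = 0] forces [a = 0]. Otherwise the order [n] divides [2a]
    but not [a], so [n] is even and [2a] is an odd multiple of [n]; thus [a] is [n/2] modulo [n]. *)
Lemma expgz_involution x a (s := expgz x a) : s <> 1 -> s * s = 1 ->
  exists n, [/\ order x = Some n, ~~ odd n & s = x ^+ n./2].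
Proof.
move=> s1 ss; have /nonzero_mod_order := s1.
have : ~ nonzero_mod (order x) (a + a)%R by move/nonzero_mod_order; rewrite expgzD.
case E: (order x) => [n|] /= /contrapT; last by lia.
move=> /dvdzP[c aE] na; exists n.
have n_even : ~~ odd n.
  apply/negP => n_odd; apply: na; rewrite -(@Gauss_dvdzr n 2).
    by apply/dvdzP; exists c; lia.
  by rewrite coprimezE coprimen2.
have nE : n = (n./2 * 2)%N by lia.
have [d [r [cE r01]]] : exists d r : int, c = (d * 2 + r)%R /\ (r = 0 \/ r = 1)%R.
  by exists (c %/ 2)%Z, (c %% 2)%Z; split; lia.
have aE' : a = (d * n%:Z + r * (n./2)%:Z)%R.
  by move: aE; rewrite cE {1}nE {2}nE PoszM; lia.
case: r01 aE' => {cE} -> aE'; last first.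
  by split=> //; rewrite /s aE' expgzD expgzMn expg_order // expgz1 mul1g /= mul1n.
by case: na; apply/dvdzP; exists d; rewrite aE'; lia.
Qed.

End IntegerPowers.

(** * Syllables, syllabic words and braid relations *)

Section SyllabicWords.
Variables (G : groupType) (X : set G).
Implicit Types (x y s t : G) (w : seq G).

(** Keeps track of the base generator; [s <> 1] replaces the condition on the exponent modulo the
    order. *)
Definition syllable_at x s :=
  [/\ X x, s <> 1 & exists a, s = expgz x a].

Lemma syllableP s : syllable X s <-> exists x, syllable_at x s.
Proof.
split=> [[x [a [Xx xa ->]]]|[x [Xx s1 [a sE]]]].
  by exists x; split=> //; [exact/nonzero_mod_order|exists a].
by exists x, a; split=> //; apply/nonzero_mod_order; rewrite -sE.
Qed.

Lemma syllable_at_syllable x s : syllable_at x s -> syllable X s.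
Proof. by move=> xs; apply/syllableP; exists x. Qed.

Lemma syllable_atV x s : syllable_at x s -> syllable_at x s^-1.
Proof.
move=> [Xx s1 [a sE]]; split=> //; last by exists (- a)%R; rewrite expgzN sE.
by move/(congr1 inv); rewrite invgK invg1.
Qed.

Lemma syllable_atM x s t : syllable_at x s -> syllable_at x t -> s * t <> 1 ->
  syllable_at x (s * t).
Proof.
move=> [Xx _ [a ->]] [_ _ [b ->]] st1; split=> //.
by exists (a + b)%R; rewrite expgzD.
Qed.

Lemma commute_syllable_at x s y t :
  syllable_at x s -> syllable_at y t -> commute x y -> commute s t.
Proof. by move=> [_ _ [a ->]] [_ _ [b ->]]; exact: commute_expgz. Qed.

Lemma wprod_nil : wprod [::] = 1 :> G.
Proof. exact: big_nil. Qed.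

Lemma wprod_cons s w : wprod (s :: w) = s * wprod w.
Proof. exact: big_cons. Qed.

Lemma wprod_cat w w' : wprod (w ++ w') = wprod w * wprod w'.
Proof. exact: big_cat. Qed.

Lemma wprod_rcons w s : wprod (rcons w s) = wprod w * s.
Proof. by rewrite -cats1 wprod_cat wprod_cons wprod_nil mulg1. Qed.

Lemma syl_length_le g m w :
  syl_length X g = Some m -> syllabic X w -> wprod w = g -> m <= size w.
Proof. by case/leastP=> _ minm Xw wg; apply: minm; exists w. Qed.

Lemma reduced_le w w' : reduced X w -> syllabic X w' -> wprod w' = wprod w ->
  size w <= size w'.
Proof. exact: syl_length_le. Qed.

Lemma syllabic_cons s w : syllable X s -> syllabic X w -> syllabic X (s :: w).
Proof. by move=> Xs Xw t; rewrite inE => /orP[/eqP->//|]; exact: Xw. Qed.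

Lemma syllabic_cat w w' :
  syllabic X (w ++ w') <-> syllabic X w /\ syllabic X w'.
Proof.
split=> [Xww'|[Xw Xw'] s]; last by rewrite mem_cat => /orP[/Xw|/Xw'].
by split=> s sw; apply: Xww'; rewrite mem_cat sw ?orbT.
Qed.

Lemma syllabic_alternate s t n :
  syllable X s -> syllable X t -> syllabic X (alternate s t n).
Proof. by move=> Xs Xt u /mem_alternate[]->. Qed.

(** A product of two syllables of one cyclic subgroup may be 1, which is not a syllable; dropping it
    keeps the word syllabic. *)
Definition cons_nontrivial s w := if s == 1 then w else s :: w.

Lemma wprod_cons_nontrivial s w : wprod (cons_nontrivial s w) = s * wprod w.
Proof.
by rewrite /cons_nontrivial; case: eqP => [->|_]; rewrite ?mul1g ?wprod_cons.
Qed.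

Lemma size_cons_nontrivial s w : size (cons_nontrivial s w) <= (size w).+1.
Proof. by rewrite /cons_nontrivial; case: eqP. Qed.

Lemma syllabic_cons_nontrivial x s t w :
  syllable_at x s -> syllable_at x t -> syllabic X w ->
  syllabic X (cons_nontrivial (s * t) w).
Proof.
rewrite /cons_nontrivial => xs xt Xw; case: eqP => // st1.
by apply: syllabic_cons => //; apply: (@syllable_at_syllable x); exact: syllable_atM.
Qed.

Definition braid s t m :=
  [/\ 1 < m, wprod (alternate s t m) = wprod (alternate t s m)
    & syl_length X (wprod (alternate s t m)) = Some m].

Lemma braid_sym s t m : braid s t m -> braid t s m.
Proof. by case=> m1 st len; split; rewrite // -st. Qed.

Lemma M_op_syllabic w w' : M_op X w w' -> syllabic X w -> syllabic X w'.
Proof.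
case=> [[w1 w2 s t Xs Xt Xst _|w1 w2 s t _ _ _]|[w1 w2 s t m Xs Xt _ _ _]].
- move=> /syllabic_cat[Xw1 /syllabic_cat[_ Xw2]]; apply/syllabic_cat; split=> //.
  exact: syllabic_cons.
- move=> /syllabic_cat[Xw1 /syllabic_cat[_ Xw2]]; exact/syllabic_cat.
- move=> /syllabic_cat[Xw1 /syllabic_cat[_ Xw2]]; apply/syllabic_cat; split=> //.
  by apply/syllabic_cat; split=> //; exact: syllabic_alternate.
Qed.

(* If [s, t]_k = [t, s]_k with k < m, then
   [t, s]_m = t [s, t]_k ... = t [t, s]_k ... = t^2 [s, t]_(k-1) ... is too short. *)
Lemma braid_min x y s t k m : syllable_at x s -> syllable_at y t ->
  braid s t m -> 0 < k < m -> wprod (alternate s t k) <> wprod (alternate t s k).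
Proof.
move=> xs yt [_ st len] /andP[k_gt0 ltkm] stk.
pose v := alternate s t k.-1 ++
  (if odd k then alternate t s (m - k.+1) else alternate s t (m - k.+1)).
have Xs := syllable_at_syllable xs; have Xt := syllable_at_syllable yt.
have Xv : syllabic X v.
  by apply/syllabic_cat; split; last case: odd; exact: syllabic_alternate.
have size_v : size v = (k.-1 + (m - k.+1))%N.
  by rewrite size_cat; case: odd; rewrite !size_alternate.
suff : wprod (cons_nontrivial (t * t) v) = wprod (alternate s t m).
  move/(syl_length_le len (syllabic_cons_nontrivial yt yt Xv)).
  have := size_cons_nontrivial (t * t) v; lia.
rewrite st -[in RHS](subnK ltkm) addnC addSn alternateS alternateD.
rewrite wprod_cons wprod_cat stk wprod_cons_nontrivial wprod_cat.
rewrite -[in alternate t s k](prednK k_gt0) alternateS wprod_cons.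
by rewrite !mulgA.
Qed.

Lemma braid_unique x y s t k m : syllable_at x s -> syllable_at y t ->
  braid s t k -> braid s t m -> k = m.
Proof.
move=> xs yt stk stm.
have not_lt i j : braid s t i -> braid s t j -> ~ i < j.
  case=> /ltnW i_gt0 stE _ stj ltij.
  by apply: (braid_min xs yt stj _ stE); rewrite i_gt0.
by have [/not_lt||] := ltngtP k m => //; [|move/not_lt]; case.
Qed.

End SyllabicWords.

(** * Braid relations under Property D *)

Section PropertyD.
Variables (G : groupType) (X : set G).
Hypotheses (hsm : strongly_marked X) (hD : property_D X).
Implicit Types (x y z s t g h : G) (w : seq G).

Lemma syllable_at_gen x : X x -> syllable_at X x x.
Proof.
move=> Xx; split=> //; last by exists (Posz 1).
by move=> x1; case: hsm => + _; rewrite -x1.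
Qed.

Lemma subgroup_gen_expgz x a : subgroup_gen [set x] (expgz x a).
Proof.
move=> H [[H1 HM HV] /(_ x erefl) Hx].
have HX n : H (x ^+ n) by elim: n => // n IHn; rewrite expgS; exact: HM.
by case: a => n /=; [|apply: HV]; exact: HX.
Qed.

Lemma mergeable_base x y s t : syllable_at X x s -> syllable_at X y t ->
  syllable X (s * t) \/ s * t = 1 -> x = y.
Proof.
move=> [Xx s1 [a sE]] [Xy t1 [b tE]]; case: hsm => _; apply=> //.
  by rewrite sE; exact: subgroup_gen_expgz.
by rewrite tE; exact: subgroup_gen_expgz.
Qed.

(** Strong marking applies to the product of [s] and its inverse. *)
Lemma syllable_at_inj x y s : syllable_at X x s -> syllable_at X y s -> x = y.
Proof.
by move=> xs /syllable_atV ys; apply: (mergeable_base xs ys); rewrite mulgV; right.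
Qed.

(** With a common base, the first two letters of the alternating word would merge or cancel, making
    its product shorter than [m]. *)
Lemma braid_neq x y s t m :
  syllable_at X x s -> syllable_at X y t -> braid X s t m -> x <> y.
Proof.
move=> xs + + xy; rewrite -{y}xy => xt [m_gt1 _ len].
have [Xs Xt] := (syllable_at_syllable xs, syllable_at_syllable xt).
case: m m_gt1 len => [|[|m]] // _ len.
have Xw := syllabic_cons_nontrivial xs xt (@syllabic_alternate _ X s t m Xs Xt).
have := syl_length_le len Xw; rewrite wprod_cons_nontrivial !alternateS.
rewrite !wprod_cons mulgA => /(_ erefl).
have := size_cons_nontrivial (s * t) (alternate s t m).
by rewrite size_alternate; lia.
Qed.

(** The block rewritten by the type II operation starts at index [i] and has length [k]; being
    alternating, it has period 2. *)
Lemma exists_type_II x y w w' : x <> y ->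
  (forall i, i < size w -> syllable_at X (if odd i then y else x) w`_i) ->
  syllabic X w' -> wprod w' = wprod w -> w' <> w -> size w' <= size w ->
  exists i k, [/\ i + k <= size w, braid X w`_i w`_i.+1 k
    & forall j, i <= j -> j.+2 < i + k -> w`_j = w`_j.+2].
Proof.
move=> xy wat Xw' ww' neq le_ww'.
have Xw : syllabic X w.
  by move=> s /(nthP 1)[i ltiw <-]; exact: (syllable_at_syllable (wat i ltiw)).
have [w1 op w1w] : exists2 w1, M_op X w w1 & w1 <> w.
  (* If [w] is reduced, then so is [w'], which is no longer, and part (b) of Property D joins them.
     Otherwise part (a) gives a sequence of operations that shortens [w]. *)
  have [rw|/(hD.1 _ Xw) nw] := pselect (reduced X w).
    have size_w' : size w' = size w.
      by apply/eqP; rewrite eqn_leq le_ww' (reduced_le rw Xw' ww').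
    have rw' : reduced X w' by rewrite /reduced ww' size_w'.
    have [|v wv vw] := clos_refl_trans_first_step (hD.2 _ _ Xw Xw' rw rw' (esym ww')).
      by move=> /esym.
    by exists v => //; right.
  move: nw => /existsNP[v /not_implyP[wv /negP]]; rewrite -ltnNge => ltvw.
  by apply: (clos_refl_trans_first_step wv) => vw; rewrite vw ltnn in ltvw.
(* Adjacent letters have different bases, so strong marking rules out type I. *)
have no_merge v1 v2 s t : w = v1 ++ [:: s; t] ++ v2 ->
    ~ (syllable X (s * t) \/ s * t = 1).
  move=> wE; have ltiw : (size v1).+1 < size w by rewrite wE !size_cat /=; lia.
  have := wat _ ltiw; have := wat _ (ltnW ltiw).
  have ltn1 : ((size v1).+1 < size v1) = false by lia.
  rewrite wE !nth_cat ltnn ltn1 subnn subSnn /=.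
  by case: odd => sat tat /(mergeable_base sat tat) //= /esym.
case: op no_merge {Xw ww' neq le_ww' Xw' w' wat} w1w.
  move=> [v1 v2 s t _ _ Xst _|v1 v2 s t _ _ st1] /(_ v1 v2 s t erefl) [].
    by left.
  by right.
move=> [v1 v2 s t m Xs Xt m_gt1 stE len] _ _.
have nthE j : j < m ->
    (v1 ++ alternate s t m ++ v2)`_(size v1 + j) = if odd j then t else s.
  move=> ltjm; rewrite nth_cat ltnNge leq_addr /= addKn.
  by rewrite nth_cat size_alternate ltjm nth_alternate.
exists (size v1), m; split.
- by rewrite !size_cat size_alternate; lia.
- have := nthE 0%N (ltnW m_gt1); have := nthE 1%N m_gt1.
  by rewrite addn0 addn1 /= => -> ->.
- move=> j le_j ltj; have [d jE] : exists d, j = (size v1 + d)%N.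
    by exists (j - size v1)%N; lia.
  rewrite jE -!addnS !nthE /= ?negbK //; lia.
Qed.

(* If [t, s]_n conjugates r to s, then the words (g, [t, s]_n, h) and
   (g s, [t, s]_n, r^-1 h) represent the same element. *)
Lemma exists_type_II_frame x y s t g h n : x <> y ->
  syllable_at X x s -> syllable_at X y t -> syllable_at X x g ->
  syllable_at X (if odd n then x else y) h ->
  s * wprod (alternate t s n) = wprod (alternate t s n) * (if odd n then s else t) ->
  let w := g :: rcons (alternate t s n) h in
  exists i k, [/\ i + k <= n.+2, braid X w`_i w`_i.+1 k
    & forall j, i <= j -> j.+2 < i + k -> w`_j = w`_j.+2].
Proof.
move=> xy xs yt xg zh; set r := (if odd n then s else t) => sD w.
have zr : syllable_at X (if odd n then x else y) r by rewrite /r; case: odd.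
have size_w : size w = n.+2 by rewrite /= size_rcons size_alternate.
pose w' := cons_nontrivial (g * s)
  (alternate t s n ++ cons_nontrivial (r^-1 * h) [::]).
have := @exists_type_II x y w w' xy; rewrite size_w; apply.
- move=> i lti; rewrite nth_frame_alternate.
  case: i lti => [|i] //= lti; case: (ltnP i n) => lein; first by case: odd.
  by case: eqP => [[->]|]; [case: (odd n) zh|lia].
- apply: (syllabic_cons_nontrivial xg xs); apply/syllabic_cat; split.
    by apply: syllabic_alternate; [apply: syllable_at_syllable yt|
      apply: syllable_at_syllable xs].
  by apply: (syllabic_cons_nontrivial (syllable_atV zr) zh).
- rewrite wprod_cons_nontrivial wprod_cat wprod_cons_nontrivial wprod_nil mulg1.
  by rewrite wprod_cons wprod_rcons mulgA -[g * s * _]mulgA sD -!mulgA mulVKg.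
(* If [g s = 1], then [w'] is shorter than [w]; otherwise their first letters differ because
   [s <> 1]. *)
- rewrite /w' {1}/cons_nontrivial; case: eqP => [_ w'w|_ [gsg _]].
    have := size_cons_nontrivial (r^-1 * h) [::].
    have := congr1 size w'w; rewrite size_w size_cat size_alternate /=; lia.
  by case: xs => _ + _; apply; apply: (mulgI g); rewrite mulg1.
- apply: leq_trans (size_cons_nontrivial _ _) _.
  rewrite size_cat size_alternate ltnS -addn1 leq_add2l.
  exact: size_cons_nontrivial.
Qed.

(** The frame is [(x, t, x^-1)]. A type II operation of length 2 swaps [t] with [x] or with [x^-1];
    one of length 3 forces [x = x^-1], so that [s], a nontrivial power of the involution [x], equals
    [x]. *)
Lemma commute_gen x y s t : x <> y -> syllable_at X x s -> syllable_at X y t ->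
  commute s t -> commute x t.
Proof.
move=> xy xs yt st; have [Xx s1 [a sE]] := xs.
have xx := syllable_at_gen Xx.
have [] := @exists_type_II_frame x y s t x x^-1 1 xy xs yt xx (syllable_atV xx).
  by rewrite alternateS wprod_cons wprod_nil mulg1.
rewrite alternateS /= => -[|[|i]] [k [lek [k_gt1 brk _] per]]; try by lia.
  case: k lek k_gt1 brk per => [|[|[|[|k]]]] // _ _ brk per.
    by move: brk; rewrite !alternateS !wprod_cons wprod_nil !mulg1.
  have x_inv : x * x = 1 by rewrite [X in _ * X](per 0%N) //= mulgV.
  have ox : order x = Some 2 by case: xx => _ x1 _; exact: order_involution.
  have [||n [on _ sn]] := @expgz_involution G x a; rewrite -?sE //.
    have aa : (a + a = a * 2%:Z)%R by lia.
    by rewrite sE -expgzD aa expgzMn expg2 x_inv expgz1.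
  by move: on; rewrite ox => -[nE]; have <- : s = x by rewrite sE sn -nE.
have {}lek : k = 2 by lia.
move: brk; rewrite lek !alternateS !wprod_cons wprod_nil !mulg1 /= => tx.
by rewrite -[x]invgK; apply/commute_sym/commuteV.
Qed.

Lemma commute_gens x y s t : x <> y -> syllable_at X x s -> syllable_at X y t ->
  commute s t -> commute x y.
Proof.
move=> xy xs yt /(commute_gen xy xs yt) /commute_sym tx; apply: commute_sym.
by case: (xs) => Xx _ _; apply: (commute_gen _ yt (syllable_at_gen Xx)) => // /esym.
Qed.

Lemma braid_gt2_cases x y s t g h m : syllable_at X x s -> syllable_at X y t ->
  braid X s t m -> 2 < m ->
  syllable_at X x g -> syllable_at X (if odd m then y else x) h ->
  g = s \/ h = if odd m then t else s.
Proof.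
move=> xs yt st_m m_gt2 xg zh; have xy := braid_neq xs yt st_m.
have not_short k : k < m -> 1 < k ->
    wprod (alternate s t k) <> wprod (alternate t s k).
  by move=> ltkm /ltnW k_gt0; apply: (braid_min xs yt st_m); rewrite k_gt0.
have not_comm u v : syllable_at X x u -> syllable_at X y v ->
    wprod (alternate u v 2) <> wprod (alternate v u 2).
  rewrite !alternateS !wprod_cons !wprod_nil !mulg1 => xu yv uv.
  apply: (not_short 2 m_gt2 isT).
  rewrite !alternateS !wprod_cons !wprod_nil !mulg1.
  exact: commute_syllable_at xs yt (commute_gens xy xu yv uv).
case: m m_gt2 st_m not_short zh => [|[|[|p]]] // _ [_ stE _] not_short.
rewrite [odd _]/= !negbK => zh.
have := @exists_type_II_frame x y s t g h p.+2 xy xs yt xg.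
rewrite [odd p.+2]/= negbK; set w := g :: _; case.
- by case: (odd p) zh.
- by move: stE; rewrite alternateS wprod_cons [in RHS]alternateSr wprod_rcons /= negbK.
- move=> i [k [lek [k_gt1 brk _] per]].
have wE j : w`_j = if j == 0%N then g else if j <= p.+2 then
   (if odd j then t else s) else if j == p.+3 then h else 1.
  exact: nth_frame_alternate.
(* A block at the start: with length 2, [g] commutes with [t], which is excluded; otherwise its
   period gives [g = s]. *)
have [i0|i_gt0] := posnP i.
  have [k2|k_gt2] := leqP k 2.
    have {}k2 : k = 2 by lia.
    by move: brk; rewrite i0 k2 !wE /= => /not_comm; case.
  by left; have := per 0%N; rewrite !wE /= i0; apply; lia.
(* A block avoiding both ends involves only [s] and [t], and its length is less than [m], contrary
   to minimality. *)
have [ik|ik] := leqP (i + k) p.+3.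
  case: (not_short k); [lia|by []|]; move: brk; rewrite !wE.
  have [-> -> ->] : [/\ i == 0%N = false, i <= p.+2 & i < p.+2] by split; lia.
  by rewrite [odd i.+1]/=; case: (odd i) => [/esym|].
(* A block at the end: the parity of [p] decides whether the letter before [h] is [s] or [t], and it
   always has the other base. Length 2 is again excluded, and otherwise the period gives the value
   of [h]. *)
have {}ik : i + k = p.+4 by lia.
have [k2|k_gt2] := leqP k 2.
  have {}k2 : k = 2 by lia.
  have {}ik : i = p.+2 by lia.
  exfalso; move: brk; rewrite ik k2 !wE ltnn leqnn eqxx /= negbK.
  by case: (odd p) zh => /= zh brk; [apply: (not_comm h t)|apply: (not_comm s h)].
have ip : i <= p.+1 by lia.
have pik : p.+3 < i + k by lia.
by right; have := per _ ip pik; rewrite !wE ltnn leqnSn eqxx => /esym.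
Qed.

Lemma braid_gt2_involution x y s t m : syllable_at X x s -> syllable_at X y t ->
  braid X s t m -> 2 < m -> s * s = 1 /\ t * t = 1.
Proof.
have inv_id (g : G) : g^-1 = g -> g * g = 1 by move=> {1}<-; rewrite mulVg.
have sq x' y' s' t' : syllable_at X x' s' -> syllable_at X y' t' ->
    braid X s' t' m -> 2 < m -> s' * s' = 1.
  move=> xs yt st m_gt2; have xsV := syllable_atV xs.
  have [m_odd|m_even] := boolP (odd m); last first.
    have := braid_gt2_cases (h := s'^-1) xs yt st m_gt2 xsV.
    by rewrite (negbTE m_even) => /(_ xsV)[]/inv_id.
  have := braid_gt2_cases (h := t'^-1) xs yt st m_gt2 xsV.
  rewrite m_odd => /(_ (syllable_atV yt))[/inv_id//|/inv_id tt].
  (* For [m] odd only [t'] may be known to be an involution; the relation reads [s' d = d t'], so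
     conjugation by [d] transfers this to [s']. *)
  case: m m_gt2 st m_odd => // n _ [_ + _] /= n_even.
  rewrite alternateS [in RHS]alternateSr wprod_cons wprod_rcons (negbTE n_even).
  set d := wprod _ => sd; apply: (mulIg d).
  by rewrite mul1g -mulgA sd mulgA sd -mulgA tt mulg1.
move=> xs yt st m_gt2; split; first exact: sq xs yt st m_gt2.
exact: sq yt xs (braid_sym st) m_gt2.
Qed.

Lemma braid_even_gen x y s t m : syllable_at X x s -> syllable_at X y t ->
  braid X s t m -> 2 < m -> ~~ odd m -> x = s.
Proof.
move=> xs yt st m_gt2 m_even; have xx : syllable_at X x x.
  by apply: syllable_at_gen; case: xs.
have := braid_gt2_cases (h := x) xs yt st m_gt2 xx.
by rewrite (negbTE m_even) => /(_ xx)[].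
Qed.

Lemma braid_odd_gen x y s t m : syllable_at X x s -> syllable_at X y t ->
  braid X s t m -> 2 < m -> odd m -> x = s \/ y = t.
Proof.
move=> xs yt st m_gt2 m_odd; have xx : syllable_at X x x.
  by apply: syllable_at_gen; case: xs.
have := braid_gt2_cases (h := y) xs yt st m_gt2 xx.
by rewrite m_odd; apply; apply: syllable_at_gen; case: yt.
Qed.

Lemma syllable_involution x s : syllable_at X x s -> s * s = 1 ->
  exists n, [/\ order x = Some n, ~~ odd n & s = x ^+ n./2].
Proof. by move=> [_ s1 [a sE]] ss; rewrite sE; apply: expgz_involution; rewrite -sE. Qed.

Lemma braid_commute x y s t m : syllable_at X x s -> syllable_at X y t ->
  braid X s t m -> (m = 2 <-> commute x y).
Proof.
move=> xs yt st; have xy := braid_neq xs yt st.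
have comm2 : wprod (alternate s t 2) = wprod (alternate t s 2) <-> commute s t.
  by rewrite !alternateS !wprod_cons !wprod_nil !mulg1.
split=> [m2|cxy].
  apply: (commute_gens xy xs yt); apply/comm2.
  by case: st => _; rewrite m2.
case: (st) => m_gt1 _ _; apply/eqP; rewrite eqn_leq m_gt1 andbT leqNgt.
apply/negP => m_gt2; apply: (@braid_min _ _ _ _ _ _ 2 _ xs yt st) => //.
exact/comm2/(commute_syllable_at xs yt).
Qed.

(** * Edge labels and the quasi-Dyer graph on [X] *)

Definition linked x y : set nat :=
  [set m | exists s t, [/\ syllable_at X x s, syllable_at X y t & braid X s t m]].

Lemma linked_sym x y m : linked x y m -> linked y x m.
Proof. by move=> [s [t [xs yt st]]]; exists t, s; split=> //; exact: braid_sym. Qed.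

Lemma linked_neq x y m : linked x y m -> x <> y.
Proof. by move=> [s [t [xs yt st]]]; exact: braid_neq st. Qed.

Lemma linked_commute x y m : linked x y m -> (m = 2 <-> commute x y).
Proof. by move=> [s [t [xs yt st]]]; exact: braid_commute st. Qed.

(** A cyclic group generated by [x] has at most one involution, the power of [x] at half its order,
    so [x] and [y] determine the pair of syllables. *)
Lemma linked_involution x y m : linked x y m -> 2 < m -> exists p q,
  [/\ order x = Some p /\ order y = Some q, ~~ odd p, ~~ odd q,
    braid X (x ^+ p./2) (y ^+ q./2) m &
    forall s t, syllable_at X x s -> syllable_at X y t -> braid X s t m ->
      s = x ^+ p./2 /\ t = y ^+ q./2].
Proof.
move=> [s [t [xs yt st]]] m_gt2.
have [ss tt] := braid_gt2_involution xs yt st m_gt2.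
have [p [xp p_even sE]] := syllable_involution xs ss.
have [q [yq q_even tE]] := syllable_involution yt tt.
exists p, q; split=> // [|s' t' xs' yt' st']; first by rewrite -sE -tE.
have [ss' tt'] := braid_gt2_involution xs' yt' st' m_gt2.
have [p' [+ _ ->]] := syllable_involution xs' ss'; rewrite xp => -[<-].
by have [q' [+ _ ->]] := syllable_involution yt' tt'; rewrite yq => -[<-].
Qed.

(** If [x] and [y] commute, both labels are 2. Otherwise both exceed 2 and come from the same pair
    of involutions, to which [braid_unique] applies. *)
Lemma linked_unique x y k m : linked x y k -> linked x y m -> k = m.
Proof.
move=> xyk xym.
have gt1 i : linked x y i -> 1 < i by move=> [s [t [_ _ []]]].
have [cxy|ncxy] := pselect (commute x y).
  by rewrite (linked_commute xyk).2 // (linked_commute xym).2.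
have gt2 i : linked x y i -> 2 < i.
  move=> xyi; rewrite ltn_neqAle gt1 // andbT eq_sym; apply/eqP => i2.
  by apply: ncxy; apply/(linked_commute xyi).
have [p [q [[xp yq] _ _ brk _]]] := linked_involution xyk (gt2 _ xyk).
have [p' [q' [[]]]] := linked_involution xym (gt2 _ xym).
rewrite xp yq => -[<-] [<-] _ _ brm _.
case: (xyk) => [s [t [xs yt st]]].
have [p'' [q'' [[]]]] := linked_involution xyk (gt2 _ xyk).
rewrite xp yq => -[<-] [<-] _ _ _ /(_ _ _ xs yt st)[sE tE].
by rewrite -sE -tE in brk brm; exact: braid_unique xs yt brk brm.
Qed.

Let vertex := {x : G | X x}.

Definition dyer_adj (u v : vertex) : Prop := exists m, linked (sval u) (sval v) m.

Definition dyer_m (u v : vertex) : nat := xget 0%N (linked (sval u) (sval v)).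

Lemma dyer_mP u v : dyer_adj u v -> linked (sval u) (sval v) (dyer_m u v).
Proof. exact: xgetPex. Qed.

Lemma dyer_adj_sym u v : dyer_adj u v -> dyer_adj v u.
Proof. by move=> [m /linked_sym]; exists m. Qed.

Lemma dyer_m_sym u v : dyer_adj u v -> dyer_m u v = dyer_m v u.
Proof.
move=> uv; apply: (linked_unique (dyer_mP uv)).
exact/linked_sym/dyer_mP/dyer_adj_sym.
Qed.

Lemma dyer_m_ge2 u v : dyer_adj u v -> 2 <= dyer_m u v.
Proof. by move=> /dyer_mP[s [t [_ _ []]]]. Qed.

Lemma dyer_f_ge2 (v : vertex) p : order (sval v) = Some p -> 2 <= p.
Proof.
by case: v => x Xx /=; apply: order_gt1; case: (syllable_at_gen Xx).
Qed.

Lemma linked_even_order x y m : linked x y m -> 2 < m -> ~~ odd m ->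
  order x = Some 2.
Proof.
move=> [s [t [xs yt st]]] m_gt2 m_even.
have [ss _] := braid_gt2_involution xs yt st m_gt2.
have xE := braid_even_gen xs yt st m_gt2 m_even; case: xs => _ s1 _.
by rewrite xE; exact: order_involution.
Qed.

Lemma dyer_even u v : dyer_adj u v -> 2 < dyer_m u v -> ~~ odd (dyer_m u v) ->
  order (sval u) = Some 2 /\ order (sval v) = Some 2.
Proof.
move=> /dyer_mP uv m_gt2 m_even; split; first exact: linked_even_order uv _ _.
exact: linked_even_order (linked_sym uv) _ _.
Qed.

Lemma dyer_odd u v : dyer_adj u v -> 2 < dyer_m u v -> odd (dyer_m u v) ->
  exists p q, [/\ order (sval u) = Some p, order (sval v) = Some q,
    ~~ odd p, ~~ odd q & p = 2 \/ q = 2].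
Proof.
move=> /dyer_mP uv m_gt2 m_odd; have [s [t [xs yt st]]] := uv.
have [p [q [[up vq] p_even q_even _ _]]] := linked_involution uv m_gt2.
have [ss tt] := braid_gt2_involution xs yt st m_gt2.
exists p, q; split=> //.
have [uE|vE] := braid_odd_gen xs yt st m_gt2 m_odd.
  left; case: xs => _ s1 _; move: up; rewrite uE order_involution //.
  by case.
right; case: yt => _ t1 _; move: vq; rewrite vE order_involution //.
by case.
Qed.

Definition dyer_graph : quasi_dyer_graph :=
  @QuasiDyerGraph vertex dyer_adj dyer_m (fun v => order (sval v))
    dyer_adj_sym (fun u uu => let: ex_intro m um := uu in linked_neq um erefl)
    dyer_m_sym dyer_m_ge2 dyer_f_ge2 dyer_even dyer_odd.

End PropertyD.

(** * Evaluation of words and morphisms from presented groups *)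

Section EvaluatedWords.
Variables (V : Type) (H : groupType) (f : V -> H).
Implicit Types u v : gword V.

Definition eval_gword u : H :=
  \prod_(p <- u) (if p.2 then (f p.1)^-1 else f p.1).

Lemma eval_gword_cat u v : eval_gword (u ++ v) = eval_gword u * eval_gword v.
Proof. exact: big_cat. Qed.

Lemma eval_gpow a n : eval_gword (gpow a n) = f a ^+ n.
Proof.
elim: n => [|n IHn]; first exact: big_nil.
by rewrite /eval_gword /gpow big_cons -/(eval_gword _) IHn expgS.
Qed.

Lemma eval_gword_alternate u v n :
  eval_gword (flatten (alternate u v n)) =
  wprod (alternate (eval_gword u) (eval_gword v) n).
Proof.
elim: n u v => [|n IHn] u v; first by rewrite [RHS]big_nil; exact: big_nil.
by rewrite !alternateS /= eval_gword_cat IHn wprod_cons.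
Qed.

(** The universal property of a presentation: evaluation respects every clause generating the
    congruence, hence factors through the quotient. *)
Lemma presented_morphism (R : gword V -> gword V -> Prop) :
  (forall u v, R u v -> eval_gword u = eval_gword v) ->
  exists phi : UMagmaMorphism.type (presented R) H,
    forall u, phi (of_gword R u) = eval_gword u.
Proof.
move=> Rf; have cong u v : rel_cong R u v -> eval_gword u = eval_gword v.
  elim=> {u v} [u v /Rf//|v b|//|//|u v w _ -> _ ->//|u u' v v' _ uu' _ vv'].
    rewrite /eval_gword !big_cons !big_nil mulg1.
    by case: b => /=; rewrite ?mulgV ?mulVg.
  by rewrite !eval_gword_cat uu' vv'.
pose phi (a : presented R) := eval_gword (to_gword a).
have phiE u : phi (of_gword R u) = eval_gword u by apply/cong/to_of_gword.
have phi1 : phi 1 = 1 by rewrite phiE; exact: big_nil.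
have phiM : {morph phi : a b / a * b}.
  move=> a b; rewrite -[a]to_gwordK -[b]to_gwordK.
  by rewrite [_ * _]presented_mulE !phiE eval_gword_cat.
pose phiMor : UMagmaMorphism.type (presented R) H :=
  HB.pack phi (isUMagmaMorphism.Build _ _ phi (phi1, phiM)).
by exists phiMor.
Qed.

End EvaluatedWords.

Lemma eval_presented_gen (V : Type) (R : gword V -> gword V -> Prop) u :
  eval_gword (presented_gen R) u = of_gword R u.
Proof.
elim: u => [|[v b] u IHu]; first exact: big_nil.
rewrite /eval_gword big_cons -/(eval_gword _ _) IHu -cat1s -[RHS]presented_mulE.
by congr (_ * _); case: b; rewrite //= [LHS]presented_invE.
Qed.

(** * Lifting syllabic words to a group satisfying the quasi-Dyer relations *)

Section Lift.
Variables (G : groupType) (X : set G).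
Hypotheses (hsm : strongly_marked X) (hD : property_D X).
Let D := dyer_graph hsm hD.
Variables (H : groupType) (e : qd_vertex D -> H).
Hypothesis e_rel : forall u v, @qd_rel D u v -> eval_gword e u = eval_gword e v.
Implicit Types (u v : qd_vertex D) (s t : G) (w : seq G).

Lemma expgz_gen_eq1 v a : expgz (sval v) a = 1 -> expgz (e v) a = 1.
Proof.
move=> va; apply: (@expgz_zero_mod _ _ (order (sval v))); last first.
  by move/nonzero_mod_order; apply.
move=> n vn; have := e_rel (@qd_rel_order D v n vn).
by rewrite eval_gpow => ->; exact: big_nil.
Qed.

Definition lift_syllable s : H :=
  xget 1 [set h | exists v a, s = expgz (sval v) a /\ h = expgz (e v) a].

(** The lift is independent of choices: a nontrivial power determines its generator, and two
    exponents giving the same power differ by one that also kills [e v]. *)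
Lemma lift_syllable_expgz v a : lift_syllable (expgz (sval v) a) = expgz (e v) a.
Proof.
have [u [b [vaE liftE]]] : exists u b, expgz (sval v) a = expgz (sval u) b /\
    lift_syllable (expgz (sval v) a) = expgz (e u) b.
  by apply: (@xgetPex _ 1 [set h | exists u b, _ /\ h = expgz (e u) b]);
    exists (expgz (e v) a), v, a.
rewrite {}liftE.
have [va1|va] := pselect (expgz (sval v) a = 1).
  by rewrite !expgz_gen_eq1 -?vaE.
have vu : v = u.
  apply: eq_sig_hprop => [x p q|]; first exact: Prop_irrelevance.
  apply: (@syllable_at_inj _ _ hsm _ _ (expgz (sval v) a)).
    by split=> //; [exact: (proj2_sig v)|exists a].
  by split=> //; [exact: (proj2_sig u)|exists b].
rewrite -{u}vu in vaE *; apply/divg1_eq; rewrite -expgzN -expgzD.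
by apply: expgz_gen_eq1; rewrite expgzD expgzN -vaE mulgV.
Qed.

Lemma lift_syllable_at x s : syllable_at X x s ->
  exists v a, [/\ sval v = x, s = expgz (sval v) a & lift_syllable s = expgz (e v) a].
Proof.
move=> [Xx _ [a sE]]; exists (exist _ x Xx), a; split=> //.
by rewrite sE -lift_syllable_expgz.
Qed.

Lemma lift_syllableM x s t : syllable_at X x s -> syllable_at X x t ->
  lift_syllable (s * t) = lift_syllable s * lift_syllable t.
Proof.
move=> [Xx _ [a ->]] [_ _ [b ->]]; pose v : qd_vertex D := exist _ x Xx.
by rewrite -expgzD !(lift_syllable_expgz v) expgzD.
Qed.

Lemma lift_syllable1 x : X x -> lift_syllable 1 = 1.
Proof. by move=> Xx; exact: (lift_syllable_expgz (exist _ x Xx) (Posz 0)). Qed.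

Definition lift_word w := wprod (map lift_syllable w).

Lemma lift_word_cat w w' : lift_word (w ++ w') = lift_word w * lift_word w'.
Proof. by rewrite /lift_word map_cat wprod_cat. Qed.

(** For [m = 2] the lifted generators commute, hence so do their powers. For [m > 2] the syllables
    are the involutions of the defining braid relation. *)
Lemma lift_word_alternate s t m : syllable X s -> syllable X t -> braid X s t m ->
  lift_word (alternate s t m) = lift_word (alternate t s m).
Proof.
move=> /syllableP[x xs] /syllableP[y yt] st.
have xy_m : linked X x y m by exists s, t.
have [u [a [ux sE ls]]] := lift_syllable_at xs.
have [v [b [vy tE lt]]] := lift_syllable_at yt.
rewrite -ux -vy in xs yt xy_m.
have uv : qd_adj u v by exists m.
have mE : qd_m u v = m by exact: linked_unique (dyer_mP uv) xy_m.
rewrite /lift_word !map_alternate.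
have [m_le2|m_gt2] := leqP m 2.
  have {m_le2} m2 : m = 2 by case: st => ? _ _; lia.
  rewrite m2 !alternateS !wprod_cons !wprod_nil !mulg1 ls lt.
  apply: commute_expgz.
  have := e_rel (@qd_rel_comm D u v uv (etrans mE m2)).
  by rewrite !eval_gword_cat !eval_gpow !expg1.
have [p [q [[up vq] _ _ _ /(_ _ _ xs yt st)[sE' tE']]]] :=
  linked_involution hsm hD xy_m m_gt2.
have -> : lift_syllable s = e u ^+ p./2.
  by rewrite sE' (lift_syllable_expgz u (Posz _)).
have -> : lift_syllable t = e v ^+ q./2.
  by rewrite tE' (lift_syllable_expgz v (Posz _)).
have m_gt2' : 2 < qd_m u v by rewrite mE.
have := e_rel (@qd_rel_braid D u v p q uv m_gt2' up vq).
by rewrite !eval_gword_alternate !eval_gpow mE.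
Qed.

Lemma M_op_wprod w w' : M_op X w w' -> wprod w = wprod w'.
Proof.
case=> [[w1 w2 s t _ _ _ _|w1 w2 s t _ _ st1]|[w1 w2 s t m _ _ _ st _]].
- by rewrite !wprod_cat !wprod_cons wprod_nil !mulgA !mulg1.
- by rewrite !wprod_cat !wprod_cons wprod_nil mulg1 st1 mul1g.
- by rewrite !wprod_cat st.
Qed.

(** Strong marking puts the two syllables of a type I operation in one cyclic subgroup, on which the
    lift is multiplicative. *)
Lemma M_op_lift_word w w' : M_op X w w' -> lift_word w = lift_word w'.
Proof.
have merge s t : syllable X s -> syllable X t -> syllable X (s * t) \/ s * t = 1 ->
    lift_word [:: s; t] = lift_syllable (s * t).
  move=> /syllableP[x xs] /syllableP[y yt] st.
  have xy := mergeable_base hsm xs yt st; rewrite -xy in yt.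
  by rewrite (lift_syllableM xs yt) /lift_word !wprod_cons wprod_nil mulg1.
case=> [[w1 w2 s t Xs Xt Xst _|w1 w2 s t Xs Xt st1]|[w1 w2 s t m Xs Xt m1 st len]].
- rewrite !lift_word_cat merge //; last by left.
  by rewrite [lift_word [:: s * t]]wprod_cons wprod_nil mulg1.
- rewrite !lift_word_cat merge //; last by right.
  by case/syllableP: Xs => x [Xx _ _]; rewrite st1 (lift_syllable1 Xx) mul1g.
- by rewrite !lift_word_cat lift_word_alternate.
Qed.

Lemma lift_word_eq1 w : syllabic X w -> wprod w = 1 -> lift_word w = 1.
Proof.
have [n] := ubnP (size w); elim: n w => // n IHn w ltwn Xw w1.
have [w0|w_gt0] := posnP (size w).
  by case: w w0 {Xw w1 ltwn} => // _; exact: wprod_nil.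
(* The empty word also represents 1 and is shorter, so [w] is not reduced. *)
have : ~ M_reduced X w.
  move=> /(hD.1 _ Xw) rw; have Xnil : syllabic X [::] by [].
  by have := reduced_le rw Xnil; rewrite wprod_nil w1 leqNgt w_gt0 => /(_ erefl).
move=> /existsNP[w' /not_implyP[ww' /negP]]; rewrite -ltnNge => ltw'w.
have [Xw' prod_w' lift_w'] : [/\ syllabic X w', wprod w' = wprod w
    & lift_word w' = lift_word w].
  elim: ww' Xw {IHn ltwn w1 w_gt0 ltw'w} => [u v uv Xu|//|u v z _ IHuv _ IHvz Xu].
    split; first exact: M_op_syllabic uv Xu.
      by rewrite (M_op_wprod uv).
    by rewrite (M_op_lift_word uv).
  have [Xv vu lvu] := IHuv Xu; have [Xz zv lzv] := IHvz Xv.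
  by rewrite zv lzv.
by rewrite -lift_w'; apply: IHn; [lia|by []|rewrite prod_w'].
Qed.

Lemma gword_syllabic (u : gword (qd_vertex D)) : exists w,
  [/\ syllabic X w, wprod w = eval_gword (fun v : qd_vertex D => sval v) u
    & lift_word w = eval_gword e u].
Proof.
elim: u => [|[v b] u [w [Xw wE lw]]].
  by exists [::]; split=> //; rewrite [LHS]wprod_nil [RHS]big_nil.
(* [Negz 0] is the exponent -1. *)
pose a : int := if b then Negz 0 else Posz 1.
exists (expgz (sval v) a :: w); split.
- apply: syllabic_cons => //; apply: (@syllable_at_syllable _ _ (sval v)).
  have vv := syllable_at_gen hsm (proj2_sig v).
  by rewrite /a; case: b {a}; [exact: syllable_atV|].
- rewrite /eval_gword big_cons -/(eval_gword _ _) wprod_cons wE.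
  by rewrite /a; case: b {a}.
- rewrite /eval_gword big_cons -/(eval_gword _ _) -lw [LHS]wprod_cons.
  by rewrite lift_syllable_expgz; rewrite /a; case: b {a}.
Qed.

Lemma eval_gword_eq1 (u : gword (qd_vertex D)) :
  eval_gword (fun v : qd_vertex D => sval v) u = 1 -> eval_gword e u = 1.
Proof. by have [w [Xw <- <-]] := gword_syllabic u; exact: lift_word_eq1. Qed.

End Lift.

(** * The isomorphism from the quasi-Dyer group onto [G] *)

Lemma dyer_graph_relations (G : groupType) (X : set G) (hsm : strongly_marked X)
    (hD : property_D X) (u v : gword (qd_vertex (dyer_graph hsm hD))) :
  qd_rel u v ->
  eval_gword (fun x : qd_vertex (dyer_graph hsm hD) => sval x) u =
  eval_gword (fun x : qd_vertex (dyer_graph hsm hD) => sval x) v.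
Proof.
case=> {u v} [v p vp|u v uv m2|u v p q uv m_gt2 up vq].
- by rewrite eval_gpow (expg_order vp) [RHS]big_nil.
- rewrite !eval_gword_cat !eval_gpow !expg1.
  exact/(linked_commute hsm hD (dyer_mP uv)).
- rewrite !eval_gword_alternate !eval_gpow.
  have [p' [q' [[]]]] := linked_involution hsm hD (dyer_mP uv) m_gt2.
  by rewrite [order _]up [order _]vq => -[<-] [<-] _ _ [].
Qed.

Theorem theorem2p3 (G : groupType) (X : set G) (hgen : generates X)
    (hsm : strongly_marked X) (hD : property_D X) :
  quasi_dyer_system X.
Proof.
have [phi phiE] := presented_morphism (@dyer_graph_relations G X hsm hD).
(* The quasi-Dyer group itself becomes the target of the lift, so a word that evaluates to 1 in [G]
   is trivial there. *)
have gen_rel u v : @qd_rel (dyer_graph hsm hD) u v ->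
    eval_gword (@qd_gen (dyer_graph hsm hD)) u = eval_gword (@qd_gen _) v.
  by move=> uv; rewrite !eval_presented_gen; apply/of_gword_eqP; exact: rel_cong_rel.
have phi_inj : injective phi.
  apply: gmulf_inj => a; rewrite -[a]to_gwordK phiE => /(eval_gword_eq1 gen_rel).
  by rewrite eval_presented_gen.
have phi_gen v : phi (qd_gen v) = sval v.
  by rewrite phiE /eval_gword big_cons big_nil mulg1.
have phi_surj g : exists a, phi a = g.
  have : subgroup_gen X g by rewrite hgen.
  (* The image of [phi] is a subgroup containing [X]. *)
  apply: (@smallest_sub _ _ _ [set g | exists a, phi a = g]) => [|x Xx]; last first.
    by exists (qd_gen (exist _ x Xx : qd_vertex (dyer_graph hsm hD))); exact: phi_gen.
  split=> [|_ _ [a <-] [b <-]|_ [a <-]]; first by exists 1; exact: gmulf1.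
    by exists (a * b); exact: gmulfM.
  by exists a^-1; exact: gmulfV.
have [psi psiK] := choice phi_surj.
exists (dyer_graph hsm hD), phi; split.
  by exists psi => // a; apply: phi_inj; rewrite psiK.
apply/seteqP; split=> [_ [_ [v _ <-] <-]|x Xx].
  by rewrite phi_gen; exact: (proj2_sig v).
pose v : qd_vertex (dyer_graph hsm hD) := exist _ x Xx.
by exists (qd_gen v); [exists v|exact: phi_gen].
Qed.
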